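(* Let $H$ be a non-cyclic $\aleph_0$-monoid generated by $x_1$ and $x_2$, and suppose that $H$ has a realization to a non-PDFG ring, i.e. $H\cong V^{\aleph_0}(R)$ as $\aleph_0$-monoids for some ring $R$ that is not PDFG. Then there exist $1\le i\neq j\le 2$ such that: (1) $x_j\notin\mathrm{add}(x_i)$. (2) $\aleph_0x_i+x_j=\aleph_0x_i$. (3) $x:=x_1+x_2$ is not a braiding element. (4) $x_i\in\mathrm{add}(x_j)$ if and only if $\aleph_0x_j=\aleph_0x_i$. (5) If $x_i\notin\mathrm{add}(x_j)$ and $\alpha X_i+\beta X_j$ and $\alpha'X_i+\beta'X_j$ are two forms of the same element of $H$ (that is, $0\le\alpha,\beta,\alpha',\beta'\le\aleph_0$ and $\alpha x_i+\beta x_j=\alpha'x_i+\beta'x_j$), then $\alpha$ and $\alpha'$ are both finite or both infinite.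
   Context: Write $\aleph_0=\{0,1,2,\dots\}$. An $\aleph_0$-monoid is a set $H$ with an element $0\in H$ and a map $\Sigma\colon H^{\aleph_0}\to H$, written $\sum_{i\in\aleph_0}x_i := \Sigma((x_i)_{i})$, such that (A1) if $x_i=0$ for all $i\neq 0$ then $\sum_{i\in\aleph_0} x_i=x_0$; (A2) for every $(x_{i,j})\in H^{\aleph_0\times\aleph_0}$ and every bijection $\pi\colon\aleph_0\times\aleph_0\to\aleph_0$, $\sum_{i}\sum_{j} x_{i,j}=\sum_{k}x_{\pi^{-1}(k)}$. Finite sums are defined by padding with zeros; in particular $H$ becomes a commutative reduced monoid. For $0\le\alpha\le\aleph_0$ and $a\in H$, $\alpha a$ is the sum of $\alpha$ copies of $a$. An isomorphism of $\aleph_0$-monoids is a bijection preserving $0$ and $\Sigma$. $\langle X\rangle_{\aleph_0}$ is the smallest $\aleph_0$-submonoid containing $X$ (subset containing $0$ and closed under $\Sigma$). $H$ is generated by $x_1,x_2$ if $H=\langle\{x_1,x_2\}\rangle_{\aleph_0}$, and cyclic if $H=\langle y\rangle_{\aleph_0}$ for some $y\in H$. If $H$ is generated by $x_1,x_2$, a form of $y\in H$ is a formal expression $\alpha X_1+\beta X_2$ with $0\le\alpha,\beta\le\aleph_0$ and $y=\alpha x_1+\beta x_2$. For $x\in H$, $\mathrm{add}(x)=\{y\in H:\ \text{there exist } z\in H,\ n\ge 1 \text{ with } y+z=nx\}$. An element $x\in H$ is a braiding element if for all families $(x_i)_{i\ge0}$, $(y_i)_{i\ge0}$ in $\mathrm{add}(x)$: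 $\sum_{i\in\aleph_0}x_i=\sum_{i\in\aleph_0}y_i$ holds if and only if there exist integers $0=m_0<m_1<\cdots$ and $0\le n_0<n_1<\cdots$ and sequences $u_0,u_1,\dots$ and $v_0=x_0,v_1,v_2,\dots$ in $\mathrm{add}(x)$ with $\sum_{i=0}^{n_0}y_i=v_0+u_0$, and for every $j\ge0$, $\sum_{i=m_j+1}^{m_{j+1}}x_i=u_j+v_{j+1}$ and $\sum_{i=n_j+1}^{n_{j+1}}y_i=u_{j+1}+v_{j+1}$. Rings are associative and unital. For a ring $R$, $V^{\aleph_0}(R)$ is the $\aleph_0$-monoid of isomorphism classes $[P]$ of countably generated projective right $R$-modules, with $\sum_i [P_i]=[\bigoplus_i P_i]$. A ring is PDFG if every projective right module is a direct sum of finitely generated modules. *)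

(* Defs.v *)
From HB Require Import structures.
From mathcomp Require Import all_boot all_algebra.
From mathcomp Require Import boolp.
Set Implicit Arguments. Unset Strict Implicit. Unset Printing Implicit Defensive.
Import GRing.Theory.

(* In [asumA], [p'] is the inverse of the bijection [p]. *)
Record aleph0_monoid : Type := Aleph0Monoid {
  carrier :> Type;
  azero : carrier;
  asum : (nat -> carrier) -> carrier;
  asum1 : forall x : nat -> carrier,
    (forall i, i <> 0 -> x i = azero) -> asum x = x 0;
  asumA : forall (x : nat * nat -> carrier)
      (p : nat * nat -> nat) (p' : nat -> nat * nat),
    cancel p p' -> cancel p' p ->
    asum (fun i => asum (fun j => x (i, j))) = asum (fun k => x (p' k))
}.
Arguments azero {_}.
Arguments asum {_} _.

(* The cardinals 0 <= alpha <= aleph_0. *)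
Inductive ecard : Type := Fin of nat | Aleph0.

Definition ecard_finite (a : ecard) : Prop := exists n, a = Fin n.

Section Aleph0Theory.
Variable H : aleph0_monoid.
Implicit Types (x y z h : H) (X S : H -> Prop).

(* Half-open range: the sum of [x i] over [m <= i < n]. *)
Definition fsum (m n : nat) (x : nat -> H) : H :=
  asum (fun k => if k < n - m then x (m + k) else azero).

Definition aadd x y : H :=
  asum (fun k => if k is k'.+1 then if k' is 0 then y else azero else x).

Definition amul (a : ecard) x : H :=
  asum (fun k => if a is Fin n then if k < n then x else azero else x).

Definition aleph0_submonoid S : Prop :=
  S azero /\ (forall x : nat -> H, (forall i, S (x i)) -> S (asum x)).

Definition generated X : H -> Prop := fun h =>
  forall S, aleph0_submonoid S -> (forall x, X x -> S x) -> S h.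

Definition generated_by2 (x : 'I_2 -> H) : Prop :=
  forall h, generated (fun z => exists i, z = x i) h.

Definition cyclic : Prop := exists y, forall h, generated (fun z => z = y) h.

(* [in_add x y] means that y belongs to add(x). *)
Definition in_add x : H -> Prop := fun y =>
  exists (z : H) (n : nat), 1 <= n /\ aadd y z = amul (Fin n) x.

Definition braiding_element x : Prop :=
  forall xs ys : nat -> H,
    (forall i, in_add x (xs i)) -> (forall i, in_add x (ys i)) ->
    (asum xs = asum ys <->
     exists (m n : nat -> nat) (u v : nat -> H),
       [/\ m 0 = 0, (forall j, m j < m j.+1) & (forall j, n j < n j.+1)] /\
       [/\ (forall j, in_add x (u j)), (forall j, in_add x (v j)) &
           v 0 = xs 0] /\
       fsum 0 (n 0).+1 ys = aadd (v 0) (u 0) /\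
       forall j,
         fsum (m j).+1 (m j.+1).+1 xs = aadd (u j) (v j.+1) /\
         fsum (n j).+1 (n j.+1).+1 ys = aadd (u j.+1) (v j.+1)).

Definition is_form x1 x2 (a b : ecard) y : Prop :=
  y = aadd (amul a x1) (amul b x2).

End Aleph0Theory.

Definition aleph0_isomorphic (H K : aleph0_monoid) : Prop :=
  exists f : H -> K, [/\ bijective f, f azero = azero &
    forall x : nat -> H, f (asum x) = asum (fun i => f (x i))].

Declare Scope aleph0_scope.
Delimit Scope aleph0_scope with A0.
Notation "x + y" := (aadd x y) : aleph0_scope.
Notation "a * x" := (amul a x) : aleph0_scope.

Local Open Scope ring_scope.

Section Modules.
Variable S : pzRingType.
Implicit Types M N : lmodType S.

Definition lmod_iso M N : Prop := exists f : {linear M -> N}, bijective f.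

Definition spans (J : Type) M (g : J -> M) : Prop :=
  forall m, exists s : seq (S * J), m = \sum_(p <- s) p.1 *: g p.2.

Definition finitely_generated M : Prop :=
  exists (n : nat) (g : 'I_n -> M), spans g.

Definition countably_generated M : Prop := exists g : nat -> M, spans g.

Definition projective M : Prop :=
  forall (A B : lmodType S) (g : {linear A -> B}) (f : {linear M -> B}),
    (forall b, exists a, g a = b) ->
    exists h : {linear M -> A}, forall m, g (h m) = f m.

Lemma lmod_iso_refl M : lmod_iso M M.
Proof. by exists idfun; exists id. Qed.

Lemma lmod_iso_sym M N : lmod_iso M N -> lmod_iso N M.
Proof.
move=> [f [f' fK f'K]]; have lf' := can2_linear fK f'K.
pose g : {linear N -> M} := HB.pack f' (GRing.isLinear.Build S N M _ f' lf').
by exists g; exists f.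
Qed.

Lemma lmod_iso_trans M N P : lmod_iso M N -> lmod_iso N P -> lmod_iso M P.
Proof. by move=> [f bf] [g bg]; exists (g \o f); apply: bij_comp. Qed.

Lemma lmod_iso_inj_surj M N (f : {linear M -> N}) :
  injective f -> (forall y, exists x, f x = y) -> lmod_iso M N.
Proof.
move=> finj fsurj; exists f.
pose g y := sval (cid (fsurj y)).
have gK y : f (g y) = y by rewrite /g; case: cid.
by exists g => // x; apply: finj; rewrite gK.
Qed.

Section DirectSum.
Variables (I : eqType) (F : I -> lmodType S).

Record dsum : Type := DSum {
  dsum_fun :> forall i, F i;
  dsum_fin : exists s : seq I, forall i, i \notin s -> dsum_fun i = 0
}.

Lemma dsum_ext (x y : dsum) : (forall i, x i = y i) -> x = y.
Proof.
case: x y => [x px] [y py] /= xy; have E : x = y by exact/functional_extensionality_dep.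
by case: y / E py {xy} => py; congr DSum; apply: Prop_irrelevance.
Qed.

Fact dsum_zero_fin : exists s : seq I, forall i, i \notin s -> 0 = 0 :> F i.
Proof. by exists [::]. Qed.
Definition dsum_zero := DSum dsum_zero_fin.

Fact dsum_opp_fin (x : dsum) :
  exists s : seq I, forall i, i \notin s -> - x i = 0.
Proof.
by case: (dsum_fin x) => s sP; exists s => i /sP ->; rewrite oppr0.
Qed.
Definition dsum_opp x := DSum (dsum_opp_fin x).

Fact dsum_add_fin (x y : dsum) :
  exists s : seq I, forall i, i \notin s -> x i + y i = 0.
Proof.
case: (dsum_fin x) (dsum_fin y) => s sP [t tP]; exists (s ++ t) => i.
by rewrite mem_cat negb_or => /andP[/sP -> /tP ->]; rewrite addr0.
Qed.
Definition dsum_add x y := DSum (dsum_add_fin x y).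

Fact dsum_scale_fin (a : S) (x : dsum) :
  exists s : seq I, forall i, i \notin s -> a *: x i = 0.
Proof. by case: (dsum_fin x) => s sP; exists s => i /sP ->; rewrite scaler0. Qed.
Definition dsum_scale a x := DSum (dsum_scale_fin a x).

HB.instance Definition _ := gen_eqMixin dsum.
HB.instance Definition _ := gen_choiceMixin dsum.

Fact dsum_addA : associative dsum_add.
Proof. by move=> x y z; apply: dsum_ext => i /=; rewrite addrA. Qed.
Fact dsum_addC : commutative dsum_add.
Proof. by move=> x y; apply: dsum_ext => i /=; rewrite addrC. Qed.
Fact dsum_add0 : left_id dsum_zero dsum_add.
Proof. by move=> x; apply: dsum_ext => i /=; rewrite add0r. Qed.
Fact dsum_addN : left_inverse dsum_zero dsum_opp dsum_add.
Proof. by move=> x; apply: dsum_ext => i /=; rewrite addNr. Qed.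
HB.instance Definition _ :=
  GRing.isZmodule.Build dsum dsum_addA dsum_addC dsum_add0 dsum_addN.

Fact dsum_scaleA a b (x : dsum) :
  dsum_scale a (dsum_scale b x) = dsum_scale (a * b) x.
Proof. by apply: dsum_ext => i /=; rewrite scalerA. Qed.
Fact dsum_scale1 : left_id 1 dsum_scale.
Proof. by move=> x; apply: dsum_ext => i /=; rewrite scale1r. Qed.
Fact dsum_scaleDr : right_distributive dsum_scale +%R.
Proof. by move=> a x y; apply: dsum_ext => i /=; rewrite scalerDr. Qed.
Fact dsum_scaleDl (x : dsum) :
  {morph dsum_scale^~ x : a b / a + b >-> a + b}.
Proof. by move=> a b; apply: dsum_ext => i /=; rewrite scalerDl. Qed.
HB.instance Definition _ := GRing.Zmodule_isLmodule.Build S dsum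
  dsum_scaleA dsum_scale1 dsum_scaleDr dsum_scaleDl.

Lemma dsum_sumE (J : Type) (s : seq J) (f : J -> dsum) i :
  (\sum_(j <- s) f j) i = \sum_(j <- s) f j i.
Proof. by elim/big_rec2: _ => // j a b _ <-. Qed.

Fact dsum_inj_fin i (a : F i) :
  exists s : seq I, forall j, j \notin s -> @dfwith I F (fun=> 0) i a j = 0.
Proof.
exists [:: i] => j; rewrite inE eq_sym => ij.
exact: (@dfwith_out I F (fun=> 0)).
Qed.
Definition dsum_inj i a : dsum := DSum (@dsum_inj_fin i a).

Fact dsum_inj_is_linear i : linear (@dsum_inj i).
Proof.
move=> a x y; apply: dsum_ext => j /=.
case: (eqVneq i j) => [<-|ij]; first by rewrite !dfwith_in.
by rewrite !dfwith_out // scaler0 addr0.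
Qed.
HB.instance Definition _ i :=
  GRing.isLinear.Build S (F i) dsum _ (@dsum_inj i) (@dsum_inj_is_linear i).

Lemma dsum_decomp (x : dsum) (s : seq I) :
  uniq s -> (forall i, i \notin s -> x i = 0) ->
  x = \sum_(i <- s) dsum_inj (x i).
Proof.
move=> us sP; apply: dsum_ext => j; rewrite dsum_sumE.
have [js|js] := boolP (j \in s); last first.
  rewrite sP // big_seq big1 // => i si.
  by rewrite /= dfwith_out //; apply: contraNneq js => <-.
rewrite (bigD1_seq j) //= dfwith_in big1 ?addr0 // => i ij.
by rewrite dfwith_out.
Qed.

Lemma dsum_supp (x : dsum) :
  exists s : seq I, uniq s /\ forall i, i \notin s -> x i = 0.
Proof.
case: (dsum_fin x) => s sP; exists (undup s); split; first exact: undup_uniq.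
by move=> i; rewrite mem_undup; apply: sP.
Qed.

Section Copair.
Variables (N : lmodType S) (h : forall i, {linear F i -> N}).

Definition dsum_copair (x : dsum) : N :=
  \sum_(i <- sval (cid (dsum_supp x))) h i (x i).

Lemma dsum_copairE (x : dsum) (s : seq I) :
  uniq s -> (forall i, i \notin s -> x i = 0) ->
  dsum_copair x = \sum_(i <- s) h i (x i).
Proof.
rewrite /dsum_copair; case: cid => t [ut tP] /= us sP.
have red (r : seq I) : \sum_(i <- r) h i (x i)
    = \sum_(i <- [seq i <- r | x i != 0]) h i (x i).
  rewrite big_filter [LHS](bigID (fun i => x i != 0)) /= [X in _ + X]big1.
    by rewrite addr0.
  by move=> i; rewrite negbK => /eqP ->; rewrite linear0.
rewrite red [RHS]red; apply: perm_big; apply: uniq_perm.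
- exact: filter_uniq.
- exact: filter_uniq.
move=> i; rewrite !mem_filter; case: eqVneq => //= xi.
transitivity true; last symmetry.
- by apply: contraNT xi => /tP ->.
- by apply: contraNT xi => /sP ->.
Qed.

Fact dsum_copair_is_linear : linear dsum_copair.
Proof.
move=> a x y; case: (dsum_supp x) (dsum_supp y) => s [us sP] [t [ut tP]].
have ust := undup_uniq (s ++ t).
have xP i : i \notin undup (s ++ t) -> x i = 0.
  by rewrite mem_undup mem_cat negb_or => /andP[/sP].
have yP i : i \notin undup (s ++ t) -> y i = 0.
  by rewrite mem_undup mem_cat negb_or => /andP[_ /tP].
rewrite !(@dsum_copairE _ (undup (s ++ t))) //; last first.
  by move=> i hi; rewrite /= xP // yP // scaler0 addr0.
rewrite scaler_sumr -big_split /=; apply: eq_bigr => i _.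
by rewrite linearP.
Qed.
HB.instance Definition _ :=
  GRing.isLinear.Build S dsum N _ dsum_copair dsum_copair_is_linear.

End Copair.

Lemma dsum_projective : (forall i, projective (F i)) -> projective dsum.
Proof.
move=> Fproj A B g f gsurj.
have hP i : exists h : {linear F i -> A}, forall m, g (h m) = f (dsum_inj m).
  exact: (Fproj i A B g (f \o @dsum_inj i)).
pose h i := sval (cid (hP i)).
exists (dsum_copair h) => x; case: (dsum_supp x) => s [us sP].
rewrite [in RHS](dsum_decomp us sP) /= (dsum_copairE h us sP) !linear_sum.
by apply: eq_bigr => i _; rewrite /h; case: cid => /= k ->.
Qed.

End DirectSum.

Lemma dsum_iso (I : eqType) (F G : I -> lmodType S) :
  (forall i, lmod_iso (F i) (G i)) -> lmod_iso (dsum F) (dsum G).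
Proof.
move=> FG.
have fgP i : exists fg : {linear F i -> G i} * (G i -> F i),
    cancel fg.1 fg.2 /\ cancel fg.2 fg.1.
  by case: (FG i) => f [g fK gK]; exists (f, g).
pose f i := (sval (cid (fgP i))).1; pose g i := (sval (cid (fgP i))).2.
have fK i : cancel (f i) (g i) by rewrite /f /g; case: cid => ? [].
have gK i : cancel (g i) (f i) by rewrite /f /g; case: cid => ? [].
have ffin (x : dsum F) : exists s : seq I, forall i, i \notin s -> f i (x i) = 0.
  by case: (dsum_fin x) => s sP; exists s => i /sP ->; rewrite linear0.
have gfin (y : dsum G) : exists s : seq I, forall i, i \notin s -> g i (y i) = 0.
  case: (dsum_fin y) => s sP; exists s => i /sP ->.
  by rewrite -[0 in LHS](linear0 (f i)) fK.
pose phi x : dsum G := DSum (ffin x).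
have philin : linear phi.
  by move=> a x y; apply: dsum_ext => i /=; rewrite linearP.
pose Phi : {linear dsum F -> dsum G} :=
  HB.pack phi (GRing.isLinear.Build S _ _ _ phi philin).
exists Phi; exists (fun y => DSum (gfin y)) => x; apply: dsum_ext => i /=.
  exact: fK.
exact: gK.
Qed.

Lemma dsum_single (I : eqType) (F : I -> lmodType S) (i0 : I) :
  (forall i, i != i0 -> forall x : F i, x = 0) -> lmod_iso (dsum F) (F i0).
Proof.
move=> F0; pose phi (x : dsum F) := x i0.
have philin : linear phi by [].
pose Phi : {linear dsum F -> F i0} :=
  HB.pack phi (GRing.isLinear.Build S _ _ _ phi philin).
exists Phi; exists (@dsum_inj I F i0) => x.
  apply: dsum_ext => i /=; case: (eqVneq i i0) => [->|ii0].
    by rewrite dfwith_in.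
  by rewrite [LHS](F0 i) // [RHS](F0 i).
by rewrite /= /phi /= dfwith_in.
Qed.

Lemma dsum_dsum (F : nat * nat -> lmodType S)
    (p : nat * nat -> nat) (p' : nat -> nat * nat) :
  cancel p p' -> cancel p' p ->
  lmod_iso (dsum (fun i => dsum (fun j => F (i, j))))
           (dsum (fun k => F (p' k))).
Proof.
move=> pK p'K.
have pair (f : forall q, F q) q : f (q.1, q.2) = 0 -> f q = 0 by case: q.
pose get (x : dsum (fun i => dsum (fun j => F (i, j)))) (q : nat * nat) : F q :=
  let: (i, j) := q in x i j.
have phifin x : exists s : seq nat, forall k, k \notin s -> get x (p' k) = 0.
  case: (dsum_fin x) => s sP.
  pose t i := sval (cid (dsum_fin (x i))).
  have tP i j : j \notin t i -> x i j = 0 by rewrite /t; case: cid => ? /= h /h.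
  exists [seq p q | q <- [seq (i, j) | i <- s, j <- t i]] => k.
  case E : (p' k) => [i j] kN /=.
  have [si|/sP ->//] := boolP (i \in s).
  apply: tP; apply: contra kN => tj; apply/mapP; exists (i, j).
    by apply/allpairsPdep; exists i, j.
  by rewrite -E p'K.
pose phi x : dsum (fun k => F (p' k)) := DSum (phifin x).
have philin : linear phi.
  by move=> a x y; apply: dsum_ext => k /=; case: (p' k).
pose Phi : {linear dsum (fun i => dsum (fun j => F (i, j)))
                   -> dsum (fun k => F (p' k))} :=
  HB.pack phi (GRing.isLinear.Build S _ _ _ phi philin).
apply: (@lmod_iso_inj_surj _ _ Phi) => [x y xy|y].
  apply: dsum_ext => i; apply: dsum_ext => j.
  have : get x (p' (p (i, j))) = get y (p' (p (i, j))).
    exact: (congr1 (fun z : dsum (fun k => F (p' k)) => z (p (i, j))) xy).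
  by rewrite pK.
pose z q : F q := eq_rect (p' (p q)) (fun q => F q) (y (p q)) q (pK q).
have zE k : z (p' k) = y k.
  rewrite /z; move: (pK (p' k)); move: (p (p' k)) (p'K k) => k' kk'.
  by case: _ / (esym kk') => e; rewrite eq_axiomK.
case: (dsum_fin y) => s sP.
have z0 q : p q \notin s -> z q = 0.
  by move=> ps; rewrite -(pK q) zE sP // pK.
have zifin i : exists t : seq nat, forall j, j \notin t -> z (i, j) = 0.
  exists [seq (p' k).2 | k <- s] => j jN; apply: z0; apply: contra jN => ks.
  by apply/mapP; exists (p (i, j)) => //; rewrite pK.
have zfin : exists t : seq nat, forall i, i \notin t ->
    DSum (zifin i) = 0 :> dsum (fun j => F (i, j)).
  exists [seq (p' k).1 | k <- s] => i iN; apply: dsum_ext => j /=.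
  apply: z0; apply: contra iN => ks.
  by apply/mapP; exists (p (i, j)) => //; rewrite pK.
exists (DSum zfin); apply: dsum_ext => k /=; rewrite -zE.
by case: (p' k).
Qed.

Lemma dsum_countably_generated (F : nat -> lmodType S) :
  (forall i, countably_generated (F i)) -> countably_generated (dsum F).
Proof.
move=> Fcg; pose g i := sval (cid (Fcg i)).
have gP i : spans (g i) by rewrite /g; case: cid.
pose G n : dsum F :=
  if unpickle n is Some (i, k) then dsum_inj (g i k) else 0.
exists G => x; case: (dsum_supp x) => s [us sP]; rewrite (dsum_decomp us sP).
elim: s {us sP} => [|i s [t IH]]; first by exists [::]; rewrite !big_nil.
rewrite big_cons {}IH; case: (gP i (x i)) => r ->.
exists ([seq (q.1, pickle (i, q.2)) | q <- r] ++ t).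
rewrite big_cat big_map linear_sum; congr (_ + _).
by apply: eq_bigr => q _; rewrite /G pickleK linearZ.
Qed.

Lemma projective_iso M N : lmod_iso M N -> projective M -> projective N.
Proof.
move=> /lmod_iso_sym[f [f' fK f'K]] Mproj A B g h gsurj.
have lf' := can2_linear fK f'K.
pose F : {linear M -> N} := HB.pack f' (GRing.isLinear.Build S M N _ f' lf').
have [k kP] := Mproj A B g (h \o F) gsurj.
by exists (k \o f) => m /=; rewrite kP /= fK.
Qed.

Lemma rV0_eq0 (x : 'rV[S]_0) : x = 0.
Proof. by apply/rowP; case. Qed.

Lemma rV0_projective : projective 'rV[S]_0.
Proof.
move=> A B g f _; exists \0 => m.
by rewrite (rV0_eq0 m) !linear0.
Qed.

Lemma rV0_countably_generated : countably_generated 'rV[S]_0.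
Proof. by exists (fun=> 0) => m; exists [::]; rewrite big_nil (rV0_eq0 m). Qed.

End Modules.

Section V.
Variable R : pzRingType.

(* Right R-modules are left modules over the opposite ring R^c. *)
Record cgproj : Type := CGProj {
  cgproj_mod :> lmodType R^c;
  cgproj_cg : countably_generated cgproj_mod;
  cgproj_proj : projective cgproj_mod
}.

Definition cgproj0 : cgproj :=
  CGProj (@rV0_countably_generated R^c) (@rV0_projective R^c).

Definition cgproj_dsum (P : nat -> cgproj) : cgproj :=
  CGProj (dsum_countably_generated (fun i => cgproj_cg (P i)))
         (dsum_projective (fun i => @cgproj_proj (P i))).

(* An isomorphism class is represented by its membership predicate. *)
Definition iso_class : Type :=
  {C : cgproj -> Prop | exists P : cgproj, C = (fun Q => lmod_iso P Q)}.

Definition class_of (P : cgproj) : iso_class :=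
  exist _ (fun Q : cgproj => lmod_iso P Q) (ex_intro _ P erefl).

Lemma class_ofP (P Q : cgproj) : class_of P = class_of Q <-> lmod_iso P Q.
Proof.
split=> [/(congr1 sval) /= /(congr1 (fun C => C Q)) ->|PQ].
  exact: lmod_iso_refl.
apply: eq_exist; apply: funext => T /=; apply: propext.
by split; apply: lmod_iso_trans => //; apply: lmod_iso_sym.
Qed.

Lemma class_of_surj (C : iso_class) : exists P, class_of P = C.
Proof. by case: C => C [P CP]; exists P; apply: eq_exist. Qed.

Definition class_repr (C : iso_class) : cgproj := sval (cid (class_of_surj C)).

Lemma class_reprK C : class_of (class_repr C) = C.
Proof. by rewrite /class_repr; case: cid. Qed.

Definition class_sum (C : nat -> iso_class) : iso_class :=
  class_of (cgproj_dsum (fun i => class_repr (C i))).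

Lemma class_sumE (P : nat -> cgproj) :
  class_sum (fun i => class_of (P i)) = class_of (cgproj_dsum P).
Proof.
apply/class_ofP; apply: dsum_iso => i.
by apply/class_ofP; rewrite class_reprK.
Qed.

Lemma class_sum1 (C : nat -> iso_class) :
  (forall i, i <> 0%N -> C i = class_of cgproj0) -> class_sum C = C 0%N.
Proof.
move=> C0; rewrite -[RHS]class_reprK; apply/class_ofP.
apply: (@dsum_single _ nat (fun i => class_repr (C i))) => i /eqP/C0 Ci x.
have /class_ofP[f [g fK _]] : class_of (class_repr (C i)) = class_of cgproj0.
  by rewrite class_reprK.
by rewrite -[x]fK -[0]fK (rV0_eq0 (f x)) (rV0_eq0 (f 0)).
Qed.

Lemma class_sumA (C : nat * nat -> iso_class)
    (p : nat * nat -> nat) (p' : nat -> nat * nat) :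
  cancel p p' -> cancel p' p ->
  class_sum (fun i => class_sum (fun j => C (i, j))) =
  class_sum (fun k => C (p' k)).
Proof.
move=> pK p'K; rewrite {2}/class_sum class_sumE; apply/class_ofP.
exact: (@dsum_dsum _ (fun q => class_repr (C q)) p p').
Qed.

Definition V_aleph0 : aleph0_monoid := Aleph0Monoid class_sum1 class_sumA.

Definition pdfg : Prop :=
  forall P : lmodType R^c, projective P ->
    exists (I : eqType) (F : I -> lmodType R^c),
      (forall i, finitely_generated (F i)) /\ lmod_iso P (dsum F).

End V.

(* Main.v *)
Require Import Defs.
From HB Require Import structures.
From mathcomp Require Import all_boot all_algebra.
From mathcomp Require Import boolp wochoice.
Set Implicit Arguments. Unset Strict Implicit. Unset Printing Implicit Defensive.
Import GRing.Theory.

(** Let [r] be the class of the regular module [R]. It is a sum of copies of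
    the two generators, and a finite one because [R] is finitely generated.
    A generator that occurs in this sum is a summand of [R], so it is finitely
    generated. If both generators were finitely generated, every countably
    generated projective module would be a direct sum of finitely generated
    ones, and by Kaplansky's theorem so would every projective module, against
    the choice of [R]. If neither were, [r] would be 0, then every class would
    be 0, and 0 is finitely generated. Hence exactly one generator [x i] is
    finitely generated, the other one [x j] does not occur in [r], and [r] is
    a finite multiple of [x i] ([one_generator_fg]). The five claims follow
    from this asymmetry.

    - Elements of add(x i) are finitely generated, so [x j] is not one.
    - [x j] is a summand of countably many copies of [r], hence of countably
      many copies of [x i], and the Eilenberg swindle [swindle] turns this
      into absorption.
    - By absorption the sequences [x i, x i, ...] and [x j, x i, x i, ...]
      have the same sum. The first step of a braiding between them would
      write [x j] as a summand of finitely many copies of [x i]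
      ([absorb_not_braiding]).
    - For the last two claims, a finitely generated module that is a summand
      of a countable direct sum is already a summand of a finite partial sum,
      and its complement in the whole sum contains the rest of the sum
      ([fg_compact]). In the monoid this is the notion [compact], from which
      the claims follow by computation.

    Kaplansky's theorem is proved with a dual basis of the projective module
    [P] and a well-order of [P]. Sets of elements that are closed under
    supports of coordinates span direct summands of [P], and adjoining one
    element to such a set adjoins only countably many. Well-ordered, these
    steps filter [P], and the successive complements are countably generated
    projective modules with direct sum [P]. *)

(** * Arithmetic of infinite sums *)

Lemma nat_pair_bijection :
  exists (p : nat * nat -> nat) (p' : nat -> nat * nat),
  cancel p p' /\ cancel p' p.
Proof.
pose p (q : nat * nat) := (2 ^ q.1 * q.2.*2.+1).-1.
pose p' k := (logn 2 k.+1, (k.+1 %/ 2 ^ logn 2 k.+1)./2).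
have pS q : (p q).+1 = 2 ^ q.1 * q.2.*2.+1.
  by rewrite prednK // muln_gt0 expn_gt0.
exists p, p'; split=> [[i j]|k].
  rewrite /p' pS /= lognM ?expn_gt0 // pfactorK // lognE /= dvdn2 /= odd_double.
  by rewrite addn0 mulKn ?expn_gt0 //= uphalf_double.
apply: succn_inj; rewrite pS /=.
have odd_cofactor : odd (k.+1 %/ 2 ^ logn 2 k.+1).
  have [m m_coprime kE] := pfactor_coprime (erefl : prime 2) (ltn0Sn k).
  by rewrite [X in X %/ _]kE mulnK ?expn_gt0 // -coprime2n.
rewrite -[_.*2.+1]/(true + _)%N -odd_cofactor odd_double_half.
by rewrite mulnC divnK // pfactor_dvdnn.
Qed.

Section MonoidLaws.
Local Open Scope A0.
Variable H : aleph0_monoid.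
Implicit Types (a b c d x y z : H) (n : nat) (u w : nat -> H).

Lemma eq_asum u w : u =1 w -> asum u = asum w.
Proof. by move=> uw; congr asum; apply/funext. Qed.

Lemma asum0 : asum (fun=> azero : H) = azero.
Proof. by rewrite asum1. Qed.

Lemma asum_exchange (t : nat -> nat -> H) :
  asum (fun i => asum (t i)) = asum (fun j => asum (t^~ j)).
Proof.
have [p [p' [pK p'K]]] := nat_pair_bijection.
rewrite (asumA (fun q => t q.1 q.2) pK p'K).
pose swap (q : nat * nat) := (q.2, q.1).
have swapK : involutive swap by case.
rewrite (@asumA H (fun q => t q.2 q.1) (p \o swap) (swap \o p')) //.
  by move=> q /=; rewrite pK swapK.
by move=> k /=; rewrite swapK p'K.
Qed.

Lemma asum_perm (s s' : nat -> nat) u :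
  cancel s s' -> cancel s' s -> asum u = asum (u \o s).
Proof.
move=> sK s'K; have [p [p' [pK p'K]]] := nat_pair_bijection.
(* Flatten the array with first column [u] along the pairing [p] twice, once
   with its rows permuted by [s]. *)
pose t q := if q.2 is 0 then u q.1 else azero.
have colE i : asum (fun j => t (i, j)) = u i by rewrite asum1 // => -[].
pose S q := (s q.1, q.2 : nat); pose S' q := (s' q.1, q.2 : nat).
have SK : cancel S S' by case=> i j; rewrite /S' /= sK.
have S'K : cancel S' S by case=> i j; rewrite /S /= s'K.
rewrite -[LHS](eq_asum colE) (@asumA H t (p \o S') (S \o p')); last 2 first.
- by move=> q /=; rewrite pK S'K.
- by move=> k /=; rewrite SK p'K.
rewrite -(@asumA H (t \o S) p p') //; apply: eq_asum => i /=.
by rewrite /S /= colE.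
Qed.

Lemma asum_single k u : (forall i, i <> k -> u i = azero) -> asum u = u k.
Proof.
move=> u0; pose s i := if i == 0 then k else if i == k then 0 else i.
have sK : involutive s.
  move=> i; rewrite /s.
  have [->|i0] := eqVneq i 0; last have [->|ik] := eqVneq i k.
  - by case: (eqVneq k 0) => [->|]; rewrite ?eqxx.
  - by rewrite eqxx.
  - by rewrite (negPf i0) (negPf ik).
rewrite (asum_perm u sK sK) asum1 => [//|i i0] /=.
apply: u0 => sik; apply: i0; rewrite -[i]sK /= sik /s.
by case: eqVneq => // _; rewrite eqxx.
Qed.

(** Exchanging the order of summation in the 0-1 array that is the graph of
    [f] moves the terms of a series along [f] without any bijection of the
    index sets having to be built. *)
Lemma asum_inj (f : nat -> nat) u : injective f ->
  (forall i, (forall j, f j <> i) -> u i = azero) -> asum u = asum (u \o f).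
Proof.
move=> finj u0; pose t i j := if f j == i then u i else azero.
have -> : asum u = asum (fun i => asum (t i)).
  apply: eq_asum => i; have [[j <-]|noj] := pselect (exists j, f j = i).
    rewrite (@asum_single j) /t ?eqxx // => k kj.
    by case: eqP => // /finj.
  rewrite u0 => [|j fj]; last by apply: noj; exists j.
  rewrite -[LHS]asum0; apply: eq_asum => j; rewrite /t.
  by case: eqP => // fj; case: noj; exists j.
rewrite asum_exchange; apply: eq_asum => j.
by rewrite (@asum_single (f j)) /t ?eqxx // => i /nesym/eqP/negPf ->.
Qed.

Lemma asum_add u w : asum (fun i => u i + w i) = asum u + asum w.
Proof.
rewrite [LHS]asum_exchange; apply: eq_asum => -[|[|k]] //; exact: asum0.
Qed.

Lemma aaddx0 x : x + azero = x.
Proof. by rewrite /aadd asum1 // => -[|[|]]. Qed.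

Lemma aadd0x x : azero + x = x.
Proof. by rewrite /aadd (@asum_single 1) // => -[|[|]]. Qed.

Lemma aaddACA a b c d : (a + b) + (c + d) = (a + c) + (b + d).
Proof.
rewrite -[RHS]asum_add; apply: eq_asum => -[|[|k]] //; by rewrite aaddx0.
Qed.

Lemma aaddC x y : x + y = y + x.
Proof.
(* The Eckmann-Hilton argument; associativity below is obtained likewise. *)
by rewrite -[x]aadd0x -[y]aaddx0 aaddACA !aadd0x !aaddx0.
Qed.

Lemma aaddA x y z : x + (y + z) = x + y + z.
Proof. by rewrite -{1}[x]aaddx0 aaddACA aadd0x. Qed.

Lemma asum_recl u : asum u = u 0 + asum (u \o S).
Proof.
pose head k := if k is 0 then u 0 else azero.
pose tail k := if k is 0 then azero else u k.
have -> : asum u = asum head + asum tail.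
  rewrite -asum_add; apply: eq_asum => -[|k] /=; first by rewrite aaddx0.
  by rewrite aadd0x.
congr (_ + _); first by rewrite asum1 // => -[].
apply: (@asum_inj S tail succn_inj); case=> // i noi; by case: (noi i).
Qed.

Lemma asum_drop m u :
  asum (fun k => if k < m then azero else u k) = asum (fun k => u (m + k)%N).
Proof.
rewrite (@asum_inj (addn m)) => [|i j /addnI //|i noi].
  by apply: eq_asum => k /=; rewrite ltnNge leq_addr.
by case: ltnP => // mi; case: (noi (i - m)); rewrite subnKC.
Qed.

Lemma amul0 x : Fin 0 * x = azero.
Proof. exact: asum0. Qed.

Lemma amulS n x : Fin n.+1 * x = x + Fin n * x.
Proof. by rewrite [LHS]asum_recl. Qed.

Lemma amul1 x : Fin 1 * x = x.
Proof. by rewrite amulS amul0 aaddx0. Qed.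

Lemma amul_aleph0S x : Aleph0 * x = x + Aleph0 * x.
Proof. by rewrite [LHS]asum_recl. Qed.

Lemma amul_aleph0D x y : Aleph0 * (x + y) = Aleph0 * x + Aleph0 * y.
Proof. exact: asum_add. Qed.

Lemma amul_aleph0K x : Aleph0 * (Aleph0 * x) = Aleph0 * x.
Proof.
have [p [p' [pK p'K]]] := nat_pair_bijection.
exact: (asumA (fun=> x) pK p'K).
Qed.

Lemma amul_aleph0_idem x : Aleph0 * x + Aleph0 * x = Aleph0 * x.
Proof. by rewrite -{2 3}amul_aleph0K -amul_aleph0S. Qed.

Lemma amul_aleph0_absorb n x : Aleph0 * x + Aleph0 * (Fin n * x) = Aleph0 * x.
Proof.
elim: n => [|n IHn]; first by rewrite amul0 [Aleph0 * azero]asum0 aaddx0.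
by rewrite amulS amul_aleph0D aaddA amul_aleph0_idem.
Qed.

(** The Eilenberg swindle: [Aleph0 * c] is its own countable multiple
    [Aleph0 * (a + b)], so it contains [Aleph0 * a], and this absorbs [a]. *)
Lemma swindle a b c : a + b = Aleph0 * c -> Aleph0 * c + a = Aleph0 * c.
Proof.
move=> ab; rewrite -amul_aleph0K -ab amul_aleph0D aaddC aaddA.
by rewrite -amul_aleph0S.
Qed.

Lemma aadd_eq0 a b : a + b = azero -> a = azero.
Proof.
move=> ab; have := amul_aleph0D a b; rewrite ab [LHS]asum0 => zero.
by rewrite -[a]aaddx0 zero aaddA -amul_aleph0S.
Qed.

Lemma in_add_intro x y z n : y + z = Fin n * x -> in_add x y.
Proof.
(* The extra copy of [x] makes the multiple positive when [n] is 0. *)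
by move=> yz; exists (z + x), n.+1; rewrite aaddA yz amulS aaddC.
Qed.

(** The elements that behave like finitely generated modules: a complement of
    such an element in a series is made of a complement in some partial sum
    and of the whole remainder of the series. *)
Definition compact a : Prop := forall b (u : nat -> H), a + b = asum u ->
  exists (m : nat) (c : H),
    asum (fun k => if k < m then u k else azero) = a + c /\
    b = c + asum (fun k => if k < m then azero else u k).

Lemma compact_series_cut a u : compact a -> a = asum u ->
  exists m, a = asum (fun k => if k < m then u k else azero).
Proof.
move=> aC aE.
have [m [c [cE /esym/aadd_eq0 c0]]] := aC _ _ (etrans (aaddx0 a) aE).
by exists m; rewrite cE c0 aaddx0.
Qed.

Lemma compact_in_add x a b (n : ecard) : compact a -> a + b = n * x ->
  in_add x a.
Proof.
move=> aC; case: n => [n|] ab; first exact: in_add_intro ab.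
have [m [c [cE _]]] := aC _ _ ab.
exact/in_add_intro/esym/cE.
Qed.

End MonoidLaws.

Local Open Scope ring_scope.

(** * Kernels, direct sums and complements of modules *)

Section Kernel.
Variables (S : pzRingType) (M N : lmodType S) (g : {linear M -> N}).

Definition ker_pred : {pred M} := fun m => g m == 0.

Fact ker_pred_closed : submod_closed ker_pred.
Proof.
split=> [|a x y]; rewrite !unfold_in ?linear0 //.
by move=> /eqP x0 /eqP y0; rewrite linearP x0 y0 scaler0 addr0.
Qed.
HB.instance Definition _ :=
  GRing.isSubmodClosed.Build S M ker_pred ker_pred_closed.

Record kernel : Type := Kernel {
  ker_val :> M;
  ker_valP : ker_val \in ker_pred
}.
HB.instance Definition _ := [isSub for ker_val].
HB.instance Definition _ := [Choice of kernel by <:].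
HB.instance Definition _ := [SubChoice_isSubLmodule of kernel by <:].

Lemma kerP (k : kernel) : g (val k) = 0.
Proof. by apply/eqP; case: k. Qed.

Lemma ker_lift (A : lmodType S) (f : {linear A -> M}) :
  (forall a, g (f a) = 0) ->
  exists f' : {linear A -> kernel}, forall a, val (f' a) = f a.
Proof.
move=> f0; have fk a : f a \in ker_pred by apply/eqP.
pose f' a := Kernel (fk a).
have f'lin : linear f' by move=> s a b; apply: val_inj; rewrite /= linearP.
by exists (HB.pack_for {linear A -> kernel} f'
  (GRing.isLinear.Build S A kernel _ f' f'lin)).
Qed.

End Kernel.

Section ModuleFacts.
Variable S : pzRingType.
Implicit Types A B C D M N : lmodType S.

Lemma spans_image M N (J : Type) (g : J -> M) (f : {linear M -> N}) :
  (forall n, exists m, f m = n) -> spans g -> spans (fun j => f (g j)).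
Proof.
move=> fsurj gP n; have [m <-] := fsurj n; have [s ->] := gP m.
exists s; rewrite linear_sum; apply: eq_bigr => q _; exact: linearZ.
Qed.

Lemma fg_image M N (f : {linear M -> N}) :
  (forall n, exists m, f m = n) -> finitely_generated M -> finitely_generated N.
Proof.
by move=> fsurj [n [g gP]]; exists n, (fun i => f (g i)); apply: spans_image.
Qed.

Lemma cg_image M N (f : {linear M -> N}) :
  (forall n, exists m, f m = n) -> countably_generated M ->
  countably_generated N.
Proof.
by move=> fsurj [g gP]; exists (fun i => f (g i)); apply: spans_image.
Qed.

Lemma fg_iso M N : lmod_iso M N -> finitely_generated M -> finitely_generated N.
Proof. by case=> f [f' _ fK]; apply: (@fg_image _ _ f) => n; exists (f' n). Qed.

Lemma fg_trivial M : (forall m : M, m = 0) -> finitely_generated M.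
Proof.
by move=> M0; exists 0%N, (fun=> 0) => m; exists [::]; rewrite big_nil.
Qed.

Lemma fg_prod M N :
  finitely_generated M -> finitely_generated N ->
  finitely_generated (M * N)%type.
Proof.
move=> [m [g gP]] [n [h hP]].
exists (m + n)%N, (fun k => match split k with
  | inl i => (g i, 0) | inr j => (0, h j) end) => -[x y].
have [s ->] := gP x; have [t ->] := hP y.
exists ([seq (q.1, lshift n q.2) | q <- s] ++
        [seq (q.1, rshift m q.2) | q <- t]).
rewrite big_cat !big_map /=.
rewrite (eq_bigr (fun q => q.1 *: (g q.2, 0 : N))); last first.
  by move=> q _; rewrite -[lshift n q.2]/(unsplit (inl q.2)) unsplitK.
rewrite [X in _ = _ + X](eq_bigr (fun q => q.1 *: (0 : M, h q.2))); last first.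
  by move=> q _; rewrite -[rshift m q.2]/(unsplit (inr q.2)) unsplitK.
have fstE (r : seq (S * 'I_m)) :
    \sum_(q <- r) q.1 *: (g q.2, 0 : N) = (\sum_(q <- r) q.1 *: g q.2, 0).
  elim: r => [|q r IHr]; rewrite ?big_nil // !big_cons IHr.
  by congr pair; rewrite /= scaler0 addr0.
have sndE (r : seq (S * 'I_n)) :
    \sum_(q <- r) q.1 *: (0 : M, h q.2) = (0, \sum_(q <- r) q.1 *: h q.2).
  elim: r => [|q r IHr]; rewrite ?big_nil // !big_cons IHr.
  by congr pair; rewrite /= scaler0 addr0.
by rewrite fstE sndE; congr pair; rewrite /= ?addr0 ?add0r.
Qed.

Lemma projective_retract M D (i : {linear M -> D}) (p : {linear D -> M}) :
  cancel i p -> projective D -> projective M.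
Proof.
move=> iK Dproj A B g f gsurj; have [h hP] := Dproj A B g (f \o p) gsurj.
by exists (h \o i) => m /=; rewrite hP /= iK.
Qed.

Lemma ker_retract A D (i : {linear A -> D}) (p : {linear D -> A}) :
  cancel i p ->
  exists q : {linear D -> kernel p},
    (forall d, val (q d) = d - i (p d)) /\ cancel (val : kernel p -> D) q.
Proof.
move=> iK; have [|q qE] := @ker_lift _ _ _ p D (idfun \- (i \o p)).
  by move=> d; rewrite /= linearB iK subrr.
exists q; split=> [//|k]; apply: val_inj.
by rewrite qE /= kerP linear0 subr0.
Qed.

Lemma pairE (M N : lmodType S) (x : M) (y : N) : (x, y) = (x, 0) + (0, y).
Proof. by congr pair; rewrite /= ?addr0 ?add0r. Qed.

Definition sum_map M N D (i : {linear M -> D}) (j : {linear N -> D})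
  (x : M * N) : D := i x.1 + j x.2.

Fact sum_map_linear M N D (i : {linear M -> D}) (j : {linear N -> D}) :
  linear (sum_map i j).
Proof.
by move=> a x y; rewrite /sum_map /= !linearP addrACA scalerDr.
Qed.
HB.instance Definition _ M N D i j :=
  GRing.isLinear.Build S (M * N)%type D _ (@sum_map M N D i j)
    (@sum_map_linear M N D i j).

Lemma retract_split A D (i : {linear A -> D}) (p : {linear D -> A}) :
  cancel i p -> bijective (sum_map i (val : kernel p -> D)).
Proof.
move=> iK; have [q [qE _]] := ker_retract iK.
exists (fun d => (p d, q d)) => [[a k]|d]; last first.
  by rewrite /sum_map /= qE addrC subrK.
have pE : p (sum_map i (val : kernel p -> D) (a, k)) = a.
  by rewrite /sum_map /= linearD iK kerP addr0.
by congr pair => //; apply: val_inj; rewrite qE pE /sum_map /= addrC addKr.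
Qed.

(** Both complements are isomorphic to the quotient by the common summand. *)
Lemma complement_unique A B C D
    (f : {linear (A * B)%type -> D}) (g : {linear (A * C)%type -> D}) :
  bijective f -> bijective g -> (forall a, f (a, 0) = g (a, 0)) -> lmod_iso B C.
Proof.
move=> [f' fK f'K] [g' gK g'K] fg; have g'lin := can2_linear gK g'K.
pose h b := (g' (f (0, b))).2.
have hlin : linear h.
  move=> a x y; rewrite /h.
  have -> : (0, a *: x + y) = a *: (0, x) + (0, y) :> A * B.
    by congr pair; rewrite /= scaler0 addr0.
  by rewrite linearP g'lin.
pose k : {linear B -> C} := HB.pack h (GRing.isLinear.Build S B C _ h hlin).
apply: (@lmod_iso_inj_surj _ _ _ k) => [|c].
  apply: (@raddf_inj _ _ k) => b kb.
  have : f (0, b) = f ((g' (f (0, b))).1, 0).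
    rewrite fg -[LHS]g'K; congr (g _).
    by rewrite [LHS]surjective_pairing; congr pair; exact: kb.
  by move=> /(can_inj fK) [].
case E : (f' (g (0, c))) => [a b]; exists b.
have fab : f (a, b) = g (0, c) by rewrite -E f'K.
rewrite /= /h -[(0, b)](addKr (a, 0)) -pairE linearD linearN fab fg.
rewrite -linearN -linearD.
by rewrite gK /= oppr0 add0r.
Qed.

(** A retraction onto [A] of the ambient module [D] restricts to [D1]; the
    kernel of the restriction together with [D2] is a complement of [A] in
    [D], hence isomorphic to the given complement [B]. *)
Lemma complement_in_summand A B D D1 D2
    (f : {linear (A * B)%type -> D}) (g : {linear (D1 * D2)%type -> D}) :
  bijective f -> bijective g -> (forall a, exists d, g (d, 0) = f (a, 0)) ->
  exists (i : {linear A -> D1}) (p : {linear D1 -> A}),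
    cancel i p /\ lmod_iso B (kernel p * D2)%type.
Proof.
move=> fbij gbij fD1; have [[f' fK f'K] [g' gK g'K]] := (fbij, gbij).
have f'lin := can2_linear fK f'K; have g'lin := can2_linear gK g'K.
have g'f a : g' (f (a, 0)) = ((g' (f (a, 0))).1, 0).
  by have [d <-] := fD1 a; rewrite gK.
pose i a := (g' (f (a, 0))).1; pose p d := (f' (g (d, 0))).1.
have inlP (M N : lmodType S) a (x y : M) :
    (a *: x + y, 0) = a *: (x, 0) + (y, 0) :> M * N.
  by congr pair; rewrite /= scaler0 addr0.
have ilin : linear i by move=> a x y; rewrite /i inlP linearP g'lin.
have plin : linear p by move=> a x y; rewrite /p inlP linearP f'lin.
pose I : {linear A -> D1} := HB.pack i (GRing.isLinear.Build S A D1 _ i ilin).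
pose P : {linear D1 -> A} := HB.pack p (GRing.isLinear.Build S D1 A _ p plin).
have gi a : g (i a, 0) = f (a, 0) by rewrite /i -g'f g'K.
have iK : cancel I P by move=> a; rewrite /= /p gi fK.
exists I, P; split=> //.
have [s' sK s'K] := retract_split iK.
pose s : {linear (A * kernel P)%type -> D1} := sum_map I (val : kernel P -> D1).
pose h (x : A * (kernel P * D2)) := g (s (x.1, x.2.1), x.2.2).
have hlin : linear h.
  move=> a x y; rewrite /h -linearP; congr (g _); congr pair.
  by rewrite -[RHS]/(a *: s (x.1, x.2.1) + s (y.1, y.2.1)) -linearP.
pose h' : {linear (A * (kernel P * D2))%type -> D} :=
  HB.pack h (GRing.isLinear.Build S (A * (kernel P * D2))%type D _ h hlin).
apply: (@complement_unique A B _ D f h') => // [|a].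
  exists (fun d => ((s' (g' d).1).1, ((s' (g' d).1).2, (g' d).2))).
    by case=> a [k d]; rewrite /= /h gK /= sK.
  by move=> d; rewrite /= /h /= -surjective_pairing s'K -surjective_pairing g'K.
by rewrite /= /h /= /s /sum_map /= addr0 gi.
Qed.

(** Beyond the finite supports of the images of finitely many generators,
    everything vanishes. *)
Lemma fg_dsum_bounded A (F : nat -> lmodType S) (i : {linear A -> dsum F}) :
  finitely_generated A ->
  exists m, forall a k, (m <= k)%N -> i a k = 0.
Proof.
move=> [n [g gP]].
have bound (x : dsum F) : exists m, forall k, (m <= k)%N -> x k = 0.
  have [s sP] := dsum_fin x; exists (\max_(k <- s) k.+1)%N => k mk; apply: sP.
  by apply: contraL mk => ks; rewrite -ltnNge;
    apply: (@leq_bigmax_seq _ s xpredT succn).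
pose b l := sval (cid (bound (i (g l)))).
have bP l k : (b l <= k)%N -> i (g l) k = 0.
  by rewrite /b; case: cid => ? /= h /h.
exists (\max_l b l) => a k mk; have [s ->] := gP a.
rewrite linear_sum dsum_sumE big1 // => q _; rewrite linearZ /= bP ?scaler0 //.
exact: leq_trans (leq_bigmax _) mk.
Qed.

Lemma dsum_prod (I : eqType) (F F1 F2 : I -> lmodType S)
    (h : forall i, {linear (F1 i * F2 i)%type -> F i}) :
  (forall i, bijective (h i)) ->
  exists g : {linear (dsum F1 * dsum F2)%type -> dsum F},
    bijective g /\ forall x y i, g (x, y) i = h i (x i, y i).
Proof.
move=> hbij.
have [h' hK h'K] : exists2 h' : forall i, F i -> F1 i * F2 i,
    forall i, cancel (h i) (h' i) & forall i, cancel (h' i) (h i).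
  have bij i : exists h', cancel (h i) h' /\ cancel h' (h i).
    by have [h' hK h'K] := hbij i; exists h'.
  by exists (fun i => sval (cid (bij i))) => i; case: cid => ? [].
have gfin (q : dsum F1 * dsum F2) :
    exists s : seq I, forall i, i \notin s -> h i (q.1 i, q.2 i) = 0.
  have [[s sP] [t tP]] := (dsum_fin q.1, dsum_fin q.2); exists (s ++ t) => i.
  rewrite mem_cat negb_or => /andP[/sP -> /tP ->]; exact: linear0.
pose g q : dsum F := DSum (gfin q).
have glin : linear g.
  move=> a x y; apply: dsum_ext => i /=; rewrite -linearP.
  by congr (h i _).
have h'0 i : h' i 0 = 0 by rewrite -[X in h' i X](linear0 (h i)) hK.
have g1fin (x : dsum F) :
    exists s : seq I, forall i, i \notin s -> (h' i (x i)).1 = 0.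
  by have [s sP] := dsum_fin x; exists s => i /sP ->; rewrite h'0.
have g2fin (x : dsum F) :
    exists s : seq I, forall i, i \notin s -> (h' i (x i)).2 = 0.
  by have [s sP] := dsum_fin x; exists s => i /sP ->; rewrite h'0.
exists (HB.pack_for {linear (dsum F1 * dsum F2)%type -> dsum F} g
  (GRing.isLinear.Build S (dsum F1 * dsum F2)%type (dsum F) _ g glin)).
split=> //.
exists (fun x => (DSum (g1fin x) : dsum F1, DSum (g2fin x) : dsum F2)).
  by move=> [x y]; congr pair; apply: dsum_ext => i /=; rewrite hK.
by move=> x; apply: dsum_ext => i /=; rewrite -surjective_pairing h'K.
Qed.

Lemma prod_iso A B C D : lmod_iso A B -> lmod_iso C D ->
  lmod_iso (A * C)%type (B * D)%type.
Proof.
move=> [f [f' fK f'K]] [g [g' gK g'K]].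
pose h (x : A * C) : B * D := (f x.1, g x.2).
have hlin : linear h by move=> a x y; congr pair; apply: linearP.
exists (HB.pack_for {linear (A * C)%type -> (B * D)%type} h
  (GRing.isLinear.Build S _ _ _ h hlin)).
by exists (fun x => (f' x.1, g' x.2)) => -[x y];
  rewrite /= /h /= ?fK ?gK ?f'K ?g'K.
Qed.

Lemma dsum_sigma (I J : eqType) (F : I -> J -> lmodType S) :
  lmod_iso (dsum (fun i => dsum (F i))) (dsum (fun q : I * J => F q.1 q.2)).
Proof.
have ffin (x : dsum (fun i => dsum (F i))) :
    exists s : seq (I * J), forall q, q \notin s -> x q.1 q.2 = 0.
  have [s sP] := dsum_fin x; pose t i := sval (cid (dsum_fin (x i))).
  have tP i j : j \notin t i -> x i j = 0 by rewrite /t; case: cid => ? /= h /h.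
  exists [seq (i, j) | i <- s, j <- t i] => -[i j] /= ijN.
  have [si|/sP->//] := boolP (i \in s); apply: tP; apply: contra ijN => tj.
  by apply/allpairsPdep; exists i, j.
pose f x : dsum (fun q : I * J => F q.1 q.2) := DSum (ffin x).
have flin : linear f by move=> a x y; apply: dsum_ext.
pose f' : {linear dsum (fun i => dsum (F i)) ->
                  dsum (fun q : I * J => F q.1 q.2)} :=
  HB.pack f (GRing.isLinear.Build S _ _ _ f flin).
apply: (@lmod_iso_inj_surj _ _ _ f') => [x y xy|y].
  apply: dsum_ext => i; apply: dsum_ext => j.
  exact: (congr1 (fun z : dsum (fun q : I * J => F q.1 q.2) => z (i, j)) xy).
have [s sP] := dsum_fin y.
have rowfin i : exists t : seq J, forall j, j \notin t -> y (i, j) = 0.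
  exists [seq q.2 | q <- s] => j jN; apply: sP; apply: contra jN => ijs.
  by apply/mapP; exists (i, j).
pose row i : dsum (F i) := DSum (rowfin i).
have colfin : exists t : seq I, forall i, i \notin t -> row i = 0.
  exists [seq q.1 | q <- s] => i iN; apply: dsum_ext => j; apply: (sP (i, j)).
  by apply: contra iN => ijs; apply/mapP; exists (i, j).
by exists (DSum colfin); apply: dsum_ext => -[i j].
Qed.

Lemma free1_projective : projective (S^o : lmodType S).
Proof.
move=> A B g f gsurj; have [a ga] := gsurj (f 1).
pose h (s : S^o) := s *: a.
have hlin : linear h by move=> s x y; rewrite /h scalerDl scalerA.
exists (HB.pack_for {linear S^o -> A} h (GRing.isLinear.Build S _ _ _ h hlin)).
by move=> s; rewrite /= /h linearZ /= ga -linearZ /=; congr (f _); apply: mulr1.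
Qed.

Lemma free1_fg : finitely_generated (S^o : lmodType S).
Proof.
exists 1%N, (fun=> 1 : S^o) => s; exists [:: (s, ord0)].
by rewrite big_seq1; apply/esym/mulr1.
Qed.

End ModuleFacts.

(** * Well-orders *)

Section WellOrder.
Variables (T : eqType) (R : rel T).
Hypothesis Rwo : well_order R.

Lemma wo_total x y : R x y || R y x.
Proof. by apply: (wo_chainW (withinW Rwo)). Qed.

Lemma wo_ind (P : T -> Prop) :
  (forall x, (forall z, R z x -> z != x -> P z) -> P x) -> forall x, P x.
Proof.
move=> step x; apply: contrapT => nPx.
have [|z [[/asboolP nPz zmin] _]] := Rwo (A := fun x => `[< ~ P x >]).
  by exists x; apply/asboolP.
apply: nPz; apply: step => w wz wNz; apply: contrapT => nPw.
have zw : R z w by apply: zmin; apply/asboolP.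
move/eqP: wNz; apply; apply: (wo_chain_antisymmetric (withinW Rwo)) => //.
by rewrite wz.
Qed.

Lemma wo_anti x y : R x y -> R y x -> x = y.
Proof.
by move=> xy yx; apply: (wo_chain_antisymmetric (withinW Rwo)); rewrite // xy.
Qed.

Lemma wo_trans x y z : R x y -> R y z -> R x z.
Proof.
move=> xy yz.
have [|m [[+ mmin] _]] := Rwo (A := [pred w | w \in [:: x; y; z]]).
  by exists x; rewrite !inE eqxx.
rewrite !inE => /or3P[]/eqP mE.
- by rewrite -mE; apply: mmin; rewrite !inE eqxx !orbT.
- by rewrite (@wo_anti x y) // -mE; apply: mmin; rewrite !inE eqxx.
- by rewrite -(@wo_anti y z) // -mE; apply: mmin; rewrite !inE eqxx orbT.
Qed.

Lemma wo_max (s : seq T) :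
  s != [::] -> exists2 x, x \in s & {in s, forall z, R z x}.
Proof.
have Rxx x : R x x by have := wo_total x x; rewrite orbb.
elim: s => // x [|y s] IHs _.
  by exists x => [|z]; rewrite ?mem_seq1 ?eqxx // => /eqP->.
have [//|z zs zmax] := IHs; case/orP: (wo_total x z) => xz.
  exists z; first by rewrite in_cons zs orbT.
  by move=> w; rewrite in_cons => /predU1P[->|/zmax].
exists x; first by rewrite in_cons eqxx.
by move=> w; rewrite in_cons => /predU1P[->|/zmax/wo_trans->].
Qed.

End WellOrder.

(** * Projective modules are direct sums of countably generated ones *)

Section SpanClosure.
Variables (S : pzRingType) (J : Type) (M : lmodType S) (g : J -> M).

Definition in_span (m : M) : Prop :=
  exists s : seq (S * J), m = \sum_(q <- s) q.1 *: g q.2.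

Lemma in_span_gen j : in_span (g j).
Proof. by exists [:: (1, j)]; rewrite big_seq1 scale1r. Qed.

Lemma in_span0 : in_span 0.
Proof. by exists [::]; rewrite big_nil. Qed.

Lemma in_spanD x y : in_span x -> in_span y -> in_span (x + y).
Proof. by move=> [s ->] [t ->]; exists (s ++ t); rewrite big_cat. Qed.

Lemma in_spanZ a x : in_span x -> in_span (a *: x).
Proof.
move=> [s ->]; exists [seq (a * q.1, q.2) | q <- s].
by rewrite big_map scaler_sumr; apply: eq_bigr => q _; rewrite scalerA.
Qed.

End SpanClosure.

Section Kaplansky.
Variables (S : pzRingType) (P : lmodType S).

Lemma scale_map_linear (p : P) : linear (fun s : S^o => (s : S) *: p).
Proof. by move=> a x y; rewrite scalerDl scalerA. Qed.
Definition scale_map p : {linear S^o -> P} :=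
  HB.pack (fun s : S^o => (s : S) *: p)
    (GRing.isLinear.Build S S^o P _ _ (scale_map_linear p)).

Definition free_on_elements : lmodType S :=
  dsum (fun _ : P => (S^o : lmodType S)).

(** A projective module is a retract of the free module on its own elements,
    so that every [p] is the linear combination of its coordinates [h p z]
    along the elements [z]. *)
Lemma dual_basis : projective P ->
  exists h : {linear P -> free_on_elements}, forall p,
    dsum_copair scale_map (h p) = p.
Proof.
move=> /(_ free_on_elements P (dsum_copair scale_map) idfun)[p|h hP];
  last by exists h.
exists (@dsum_inj S P (fun _ => S^o : lmodType S) p 1).
rewrite [LHS](@dsum_copairE _ _ _ _ scale_map _ [:: p]) ?big_seq1 //= => [|i].
  by rewrite dfwith_in scale1r.
by rewrite inE eq_sym => pi; apply: (@dfwith_out P (fun=> S^o) (fun=> 0)).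
Qed.

Variable h : {linear P -> free_on_elements}.
Hypothesis hK : forall p, dsum_copair scale_map (h p) = p.

Definition coord (p z : P) : S := h p z.

Definition supp (p : P) : seq P := sval (cid (dsum_supp (h p))).

Lemma supp_uniq p : uniq (supp p).
Proof. by rewrite /supp; case: cid => ? []. Qed.

Lemma suppP p z : z \notin supp p -> coord p z = 0.
Proof. by rewrite /supp; case: cid => ? []/= _ /[apply]. Qed.

Section Projection.
Variable Y : P -> Prop.

Definition restrict (z : P) : P := if `[< Y z >] then z else 0.

(** When [Y] is closed under supports, this is a projection of [P] onto the
    submodule spanned by [Y]. *)
Definition proj : {linear P -> P} :=
  dsum_copair (fun z => scale_map (restrict z)) \o h.

Lemma projE p : proj p = \sum_(z <- supp p) coord p z *: restrict z.
Proof. by apply: dsum_copairE => [|z]; [apply: supp_uniq|apply: suppP]. Qed.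

Lemma proj_eq (M : lmodType S) (f g : {linear P -> M}) p :
  (forall z, Y z -> f z = g z) -> f (proj p) = g (proj p).
Proof.
move=> fg; rewrite projE !linear_sum; apply: eq_bigr => z _.
rewrite !linearZ /= /restrict; congr (_ *: _).
by case: asboolP => [/fg|_]; rewrite ?linear0.
Qed.

Definition support_closed : Prop := forall w z, Y w -> z \in supp w -> Y z.

Lemma proj_id w : support_closed -> Y w -> proj w = w.
Proof.
move=> Yclosed Yw; rewrite projE -[RHS]hK.
rewrite [RHS](@dsum_copairE _ _ _ _ scale_map (h w) _ (supp_uniq w) (@suppP w)).
apply: eq_big_seq => z /(Yclosed _ _ Yw)/asboolP Yz.
by rewrite /= /restrict Yz.
Qed.

End Projection.

Lemma proj_sub (Y Z : P -> Prop) p :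
  (forall z, Y z -> Z z) -> support_closed Z ->
  proj Z (proj Y p) = proj Y p.
Proof.
move=> YZ Zclosed; apply: (@proj_eq Y _ (proj Z) idfun) => z /YZ.
exact: proj_id.
Qed.

Fixpoint reach_seq (p : P) n : seq P :=
  if n is n'.+1 then flatten [seq supp w | w <- reach_seq p n'] else [:: p].

(** The smallest set containing [p] that is closed under supports; it is
    countable because supports are finite. *)
Definition reach p w : Prop := exists n, w \in reach_seq p n.

Lemma reach_refl p : reach p p.
Proof. by exists 0%N; rewrite /= mem_seq1. Qed.

Lemma reach_closed p : support_closed (reach p).
Proof.
move=> w z [n wn] zw; exists n.+1; apply/flattenP; exists (supp w) => //.
exact: map_f.
Qed.

Definition reach_enum p k : P :=
  if unpickle k is Some (n, i) then nth 0 (reach_seq p n) i else 0.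

Lemma reach_enumP p w : reach p w -> exists k, reach_enum p k = w.
Proof.
move=> [n wn]; exists (pickle (n, index w (reach_seq p n))).
by rewrite /reach_enum pickleK nth_index.
Qed.

Variable R : rel P.
Hypothesis Rwo : well_order R.

Definition below x w : Prop := exists z, [/\ R z x, z != x & reach z w].
Definition upto x w : Prop := reach x w \/ below x w.

Lemma below_closed x : support_closed (below x).
Proof.
by move=> w z [y [yx yNx yw]] zw; exists y; split=> //; apply: reach_closed zw.
Qed.

Lemma upto_closed x : support_closed (upto x).
Proof.
move=> w z [xw|xw] zw; first by left; apply: reach_closed zw.
by right; apply: below_closed zw.
Qed.

Lemma upto_below x z w : R z x -> z != x -> upto z w -> below x w.
Proof.
move=> zx zNx [zw|[y [yz yNz yw]]]; first by exists z.
exists y; split=> //; first exact: (wo_trans Rwo) yz zx.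
by apply: contraNneq zNx => yx; rewrite yx in yz; apply/eqP/(wo_anti Rwo).
Qed.

Definition slice_def x (p : P) : P * P :=
  (proj (below x) p, proj (upto x) p - p).

Fact slice_def_linear x : linear (slice_def x).
Proof.
move=> a p q; congr pair; first exact: linearP.
exact: (linearP (proj (upto x) \- idfun)).
Qed.
HB.instance Definition _ x :=
  GRing.isLinear.Build S P (P * P)%type _ (slice_def x) (slice_def_linear x).

(** The complement of the span of [below x] in the span of [upto x], as the
    set of elements killed by the first projection and fixed by the second. *)
Definition slice x : lmodType S := kernel (slice_def x).

Lemma slice_below x (c : slice x) : proj (below x) (val c) = 0.
Proof. by have [] := kerP c. Qed.

Lemma slice_upto x (c : slice x) : proj (upto x) (val c) = val c.
Proof. by have [_ /eqP] := kerP c; rewrite subr_eq0 => /eqP. Qed.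

Lemma slice_retract x : exists e : {linear P -> slice x},
  (forall p, val (e p) = proj (upto x) p - proj (below x) (proj (upto x) p)) /\
  (forall c, e (val c) = c).
Proof.
have [|e eE] := @ker_lift _ _ _ (slice_def x) P
  ((idfun \- proj (below x)) \o proj (upto x)).
  move=> p; set A := proj (upto x) p.
  rewrite -[LHS]/(slice_def x (A - proj (below x) A)) /slice_def.
  rewrite (linearB (proj (below x))) (linearB (proj (upto x))).
  have sub w : below x w -> upto x w by right.
  rewrite (proj_sub _ sub (@upto_closed x)).
  rewrite (proj_sub _ (fun _ => id) (@upto_closed x)).
  by rewrite (proj_sub _ (fun _ => id) (@below_closed x)) !subrr.
exists e; split=> [p|c]; first by rewrite eE.
apply: val_inj; rewrite eE.
rewrite -[LHS]/(proj (upto x) (val c) - proj (below x) (proj (upto x) (val c))).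
by rewrite slice_upto slice_below subr0.
Qed.

Lemma slice_cg x : countably_generated (slice x).
Proof.
have [e [eE eK]] := slice_retract x.
exists (fun k => e (reach_enum x k)) => c; rewrite -[c]eK -slice_upto projE.
rewrite linear_sum.
apply: (big_ind (in_span (fun k => e (reach_enum x k)))) => [||z _].
- exact: in_span0.
- exact: in_spanD.
rewrite linearZ; apply: in_spanZ; rewrite /restrict.
case: asboolP => [|_]; last by rewrite linear0; apply: in_span0.
case=> [/reach_enumP[k <-]|zx].
  exact: (in_span_gen (fun k => e (reach_enum x k))).
have -> : e z = 0; last exact: in_span0.
have zup : upto x z by right.
apply: val_inj; rewrite eE (proj_id (@upto_closed x) zup).
by rewrite (proj_id (@below_closed x) zx) subrr.
Qed.

Lemma slice_projective x : projective P -> projective (slice x).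
Proof.
have [e [_ eK]] := slice_retract x.
by apply: (projective_retract (i := val) (p := e)).
Qed.

Definition slice_sum : {linear dsum slice -> P} :=
  dsum_copair (fun x => (val : slice x -> P)).

Lemma slice_sum_surj p : exists d, slice_sum d = p.
Proof.
suff gen x : forall q, proj (upto x) q = q -> exists d, slice_sum d = q.
  by apply: (gen p); apply: proj_id (@upto_closed p) _; left; apply: reach_refl.
elim/(wo_ind Rwo): x => x IHx q qx; have [e [eE _]] := slice_retract x.
have [d dE] : exists d, slice_sum d = proj (below x) q.
  rewrite projE; apply: (big_ind (fun y => exists d, slice_sum d = y)).
  - by exists 0; apply: linear0.
  - by move=> _ _ [d1 <-] [d2 <-]; exists (d1 + d2); apply: linearD.
  move=> z _; suff [d dz] : exists d, slice_sum d = restrict (below x) z.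
    by exists (coord q z *: d); rewrite linearZ dz.
  rewrite /restrict; case: asboolP => [[y [yx yNx yz]]|_];
    last by exists 0; apply: linear0.
  by apply: (IHx y yx yNx); apply: proj_id (@upto_closed y) _; left.
exists (d + dsum_inj (e q)); rewrite linearD dE.
rewrite [slice_sum (dsum_inj _)](@dsum_copairE _ _ _ _ _ _ [:: x]) //;
  last first.
  by move=> i; rewrite inE eq_sym => xi; apply: (@dfwith_out P slice (fun=> 0)).
by rewrite big_seq1 /= dfwith_in eE qx addrC subrK.
Qed.

(** Were a nonzero family to have sum 0, projecting away the span of
    [below x], where [x] is the last index with a nonzero entry, would leave
    that entry alone. *)
Lemma slice_sum_inj : injective slice_sum.
Proof.
apply: raddf_inj => d d0; apply: dsum_ext.
have [s [us sP]] := dsum_supp d.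
apply: contrapT => /existsNP[x0 dx0].
have [|x] := @wo_max _ _ Rwo [seq z <- s | `[< d z <> 0 >]].
  have: x0 \in [seq z <- s | `[< d z <> 0 >]]; last by case: (filter _ _).
  rewrite mem_filter; apply/andP.
  by split; [apply/asboolP|apply: contrapT => /negP/sP].
rewrite mem_filter => /andP[/asboolP dx xs] xmax; apply: dx.
have other z : z \in s -> z != x ->  proj (below x) (val (d z)) = val (d z).
  move=> zs zNx; have [->|dz] := pselect (d z = 0); first by rewrite !linear0.
  have zx : R z x by apply: xmax; rewrite mem_filter zs andbT; apply/asboolP.
  rewrite -slice_upto; apply: proj_sub (@below_closed x).
  by move=> w; apply: upto_below.
have sum0 : \sum_(z <- s) val (d z) = 0.
  by rewrite -[RHS]d0 /= (dsum_copairE _ us sP).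
rewrite (bigD1_seq x) //= in sum0; set T := \sum_(z <- s | _) _ in sum0.
have TE : proj (below x) T = T.
  rewrite linear_sum [LHS]big_seq_cond [RHS]big_seq_cond.
  by apply: eq_bigr => z /andP[]; apply: other.
have T0 : T = 0.
  have := congr1 (proj (below x)) sum0.
  by rewrite linearD slice_below TE linear0 add0r.
by apply: val_inj; rewrite -[LHS]addr0 -T0.
Qed.

End Kaplansky.

(** Kaplansky's theorem. The filtration is indexed by [P] itself along an
    arbitrary well-order; taking the differences between [upto x] and [below x]
    treats successor and limit stages alike. *)
Theorem kaplansky (S : pzRingType) (P : lmodType S) : projective P ->
  exists (I : eqType) (C : I -> lmodType S),
    (forall i, countably_generated (C i) /\ projective (C i)) /\
    lmod_iso P (dsum C).
Proof.
move=> Pproj; have [h hK] := dual_basis Pproj.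
have [R Rwo] := well_ordering_principle P.
exists P, (slice h R); split=> [x|].
  by split; [apply: slice_cg|apply: slice_projective].
by apply: lmod_iso_sym;
  apply: lmod_iso_inj_surj (slice_sum_inj _ _) (slice_sum_surj _ _).
Qed.

(** * Finitely generated classes *)

(** Choosing a module in each class lets an isomorphism onto [V_aleph0 R] be
    used without mentioning classes. *)
Record realization (H : aleph0_monoid) (R : pzRingType) (M : H -> cgproj R) :
  Prop := {
  real_inj : forall h k, lmod_iso (M h) (M k) -> h = k;
  real_surj : forall P : cgproj R, exists h, lmod_iso (M h) P;
  real_zero : forall m : M azero, m = 0;
  real_sum : forall u : nat -> H,
    lmod_iso (M (asum u)) (dsum (fun i => M (u i)))
}.

Lemma realization_exists (H : aleph0_monoid) (R : pzRingType) :
  aleph0_isomorphic H (V_aleph0 R) -> exists M, @realization H R M.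
Proof.
move=> [f [[g fK gK] f0 fsum]]; exists (fun h => class_repr (f h)); split.
- by move=> h k /class_ofP; rewrite !class_reprK => /(can_inj fK).
- by move=> P; exists (g (class_of P)); apply/class_ofP; rewrite gK class_reprK.
- have /class_ofP[i [j iK _]] :
    class_of (class_repr (f azero)) = class_of (cgproj0 R).
    by rewrite class_reprK f0.
  by move=> m; rewrite -[m]iK -[0]iK (rV0_eq0 (i m)) (rV0_eq0 (i 0)).
- move=> u.
  apply/(@class_ofP R _ (cgproj_dsum (fun i => class_repr (f (u i))))).
  by rewrite class_reprK fsum.
Qed.

Section Realization.
Variables (H : aleph0_monoid) (R : pzRingType) (M : H -> cgproj R).
Hypothesis real : realization M.
Local Notation S := (R^c).

Lemma real_add (a b : H) : lmod_iso (M a * M b)%type (M (aadd a b)).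
Proof.
pose u k := if k is k'.+1 then if k' is 0%N then b else azero else a.
apply: lmod_iso_trans (lmod_iso_sym (real_sum real u)).
pose f (x : dsum (fun i => M (u i))) : M a * M b := (x 0%N, x 1%N).
have flin : linear f by move=> s x y; congr pair.
pose f' : {linear dsum (fun i => M (u i)) -> (M a * M b)%type} :=
  HB.pack f (GRing.isLinear.Build S _ _ _ f flin).
apply: lmod_iso_sym.
apply: (@lmod_iso_inj_surj _ _ _ f') => [x y [x0 x1]|[x y]].
  by apply: dsum_ext => -[|[|k]] //; rewrite [LHS]real_zero ?[RHS]real_zero.
exists (@dsum_inj _ nat (fun i => M (u i)) 0%N x +
        @dsum_inj _ nat (fun i => M (u i)) 1%N y).
by congr pair; rewrite /= !(dfwith_in, dfwith_out) ?addr0 ?add0r.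
Qed.

Definition fg (h : H) : Prop := finitely_generated (M h).

Lemma fg0 : fg azero.
Proof. exact/fg_trivial/real_zero. Qed.

Lemma fg_add a b : fg a -> fg b -> fg (aadd a b).
Proof. by move=> fga fgb; apply: fg_iso (real_add a b) _; apply: fg_prod. Qed.

Lemma fg_summand a b : fg (aadd a b) -> fg a.
Proof.
have [f [g gK fK]] := lmod_iso_sym (real_add a b).
apply: (@fg_image _ _ _ (fst \o f)) => x.
by exists (g (x, 0)); rewrite /= fK.
Qed.

Lemma fg_amul n a : fg a -> fg (amul (Fin n) a).
Proof.
by move=> fga; elim: n => [|n]; rewrite ?amul0 ?amulS;
  [apply: fg0|apply: fg_add].
Qed.

Lemma fg_in_add a b : fg a -> in_add a b -> fg b.
Proof.
move=> fga [c [n [_ bc]]]; apply: (@fg_summand b c).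
by rewrite bc; apply: fg_amul.
Qed.

Lemma retract_complement a (D : cgproj R) (i : {linear M a -> D})
    (p : {linear D -> M a}) : cancel i p ->
  exists c, lmod_iso (M c) (kernel p) /\ lmod_iso (M (aadd a c)) D.
Proof.
move=> iK; have [q [_ qK]] := ker_retract iK.
have kcg : countably_generated (kernel p).
  by apply: (@cg_image _ _ _ q) => [k|]; [exists (val k)|apply: cgproj_cg].
have kproj : projective (kernel p).
  by apply: projective_retract qK (@cgproj_proj _ D).
have [c cE] := real_surj real (CGProj kcg kproj).
exists c; split=> //; apply: lmod_iso_trans (lmod_iso_sym (real_add a c)) _.
apply: lmod_iso_trans (prod_iso (lmod_iso_refl _) cE) _.
by exists (sum_map i (val : kernel p -> D)); apply: retract_split.
Qed.

(** The image of [M a] lies in the partial sum up to a bound [m] for its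
    generators; the module complementary to it there is the class [c]. *)
Lemma fg_compact a : fg a -> compact a.
Proof.
move=> fga b u abu.
have [f fbij] : lmod_iso (M a * M b)%type (dsum (fun k => M (u k))).
  by apply: lmod_iso_trans (real_add a b) _; rewrite abu; apply: real_sum.
pose i x := f (x, 0).
have ilin : linear i.
  move=> s x y; rewrite /i -linearP; congr (f _).
  by congr pair; rewrite /= scaler0 addr0.
pose i' : {linear M a -> dsum (fun k => M (u k))} :=
  HB.pack i (GRing.isLinear.Build S _ _ _ i ilin).
have [m mP] := fg_dsum_bounded i' fga.
pose u1 k := if (k < m)%N then u k else azero.
pose u2 k := if (k < m)%N then azero else u k.
have hP k : exists h : {linear (M (u1 k) * M (u2 k))%type -> M (u k)},
    bijective h.
  have uE : aadd (u1 k) (u2 k) = u k.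
    by rewrite /u1 /u2; case: ltnP => _; rewrite ?aaddx0 ?aadd0x.
  by have := real_add (u1 k) (u2 k); rewrite uE.
have hbij k : bijective (sval (cid (hP k))) by case: cid.
have [g [gbij gE]] := dsum_prod hbij.
have fD1 x : exists d, g (d, 0) = f (x, 0).
  have [g' gK g'K] := gbij; case gx : (g' (f (x, 0))) => [d e]; exists d.
  rewrite -[RHS]g'K gx; congr (g (d, _)); apply: dsum_ext => k.
  have [km|mk] := ltnP k m.
    have u2z : forall y : M (u2 k), y = 0 by rewrite /u2 km; apply: real_zero.
    by rewrite [RHS]u2z.
  have /(bij_inj (hbij k)) [_ <-//] :
    sval (cid (hP k)) (0, 0) = sval (cid (hP k)) (d k, e k).
  by rewrite -gE -gx g'K [RHS](mP x k mk) linear0.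
have [j [p [jK bE]]] := complement_in_summand fbij gbij fD1.
have [c [cE D1E]] :=
  @retract_complement a (cgproj_dsum (fun k => M (u1 k))) j p jK.
exists m, c; split; apply: (real_inj real).
  exact: lmod_iso_trans (real_sum real u1) (lmod_iso_sym D1E).
apply: lmod_iso_trans bE _; apply: lmod_iso_trans (real_add c _).
by apply: prod_iso; apply: lmod_iso_sym => //; apply: real_sum.
Qed.

(** A projective module splits off from the countable free module that maps
    onto it. *)
Lemma complement_in_free r a : lmod_iso (M r) (S^o : lmodType S) ->
  exists b, aadd a b = amul Aleph0 r.
Proof.
move=> rE; pose D : lmodType S := dsum (fun _ : nat => (S^o : lmodType S)).
have DE : lmod_iso (M (amul Aleph0 r)) D.
  by apply: lmod_iso_trans (real_sum real _) _; apply: dsum_iso.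
have [[F [F' _ FK]] [g gP]] := (DE, cgproj_cg (M a)).
pose p : {linear D -> M a} := dsum_copair (fun k => scale_map (g k)).
have psurj x : exists d, (p \o F) d = x.
  suff [d <-] : exists d, p d = x by exists (F' d); rewrite /= FK.
  have [s ->] := gP x; apply: (big_ind (fun y => exists d, p d = y)).
  - by exists 0; apply: linear0.
  - by move=> _ _ [d <-] [e <-]; exists (d + e); apply: linearD.
  move=> [c k] _; exists (@dsum_inj S nat (fun _ => S^o : lmodType S) k c).
  rewrite [LHS](@dsum_copairE _ _ _ _ (fun k => scale_map (g k)) _ [:: k]) //
    => [|l].
    by rewrite big_seq1 /= dfwith_in.
  by rewrite inE eq_sym => kl; apply: (@dfwith_out nat (fun=> S^o) (fun=> 0)).
have [i iK] := @cgproj_proj R (M a) _ _ (p \o F) idfun psurj.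
have [c [_ cE]] := @retract_complement a (M (amul Aleph0 r)) i (p \o F) iK.
by exists c; apply: (real_inj real).
Qed.

(** * The generators *)

Lemma generated_series (X : H -> Prop) h : generated X h ->
  exists u : nat -> H, (forall k, u k = azero \/ X (u k)) /\ h = asum u.
Proof.
move=> /(_ (fun h => exists u : nat -> H,
  (forall k, u k = azero \/ X (u k)) /\ h = asum u)); apply.
  split; first by exists (fun=> azero); rewrite asum0; split=> //; left.
  move=> v vP; pose u i := sval (cid (vP i)).
  have uP i k : u i k = azero \/ X (u i k) by rewrite /u; case: cid => ? [].
  have vE i : v i = asum (u i) by rewrite /u; case: cid => ? [].
  have [p [p' [pK p'K]]] := nat_pair_bijection.
  exists (fun k => u (p' k).1 (p' k).2); split=> //.
  rewrite -(asumA (fun q => u q.1 q.2) pK p'K); exact: eq_asum.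
move=> x Xx; exists (fun k => if k is 0%N then x else azero); split.
  by case=> [|k]; [right|left].
by rewrite asum1 // => -[].
Qed.

Lemma finite_combination (x : 'I_2 -> H) m (u : nat -> H) :
  (forall k, u k = azero \/ exists i, u k = x i) ->
  exists n0 n1, asum (fun k => if (k < m)%N then u k else azero) =
    aadd (amul (Fin n0) (x ord0)) (amul (Fin n1) (x ord_max)).
Proof.
elim: m u => [|m IHm] u uP.
  by exists 0%N, 0%N; rewrite !amul0 aaddx0; apply: asum0.
have [n0 [n1 nE]] := IHm (u \o succn) (fun k => uP k.+1).
rewrite asum_recl [X in aadd _ X]nE /=.
have [->|[i ->]] := uP 0%N; first by exists n0, n1; rewrite aadd0x.
case: (eqVneq i ord0) => [->|i0].
  by exists n0.+1, n1; rewrite amulS aaddA.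
have -> : i = ord_max by apply/val_inj; case: i i0 => -[|[|]].
by exists n0, n1.+1; rewrite amulS !aaddA [aadd (x _) _]aaddC.
Qed.

(** By Kaplansky's theorem a projective module is a direct sum of countably
    generated ones, whose classes are series in the generators. *)
Lemma fg_generators_pdfg (x : 'I_2 -> H) :
  generated_by2 x -> (forall i, fg (x i)) -> pdfg R.
Proof.
move=> xgen xfg P /kaplansky[I [C [CP PC]]].
have GP i : exists G : nat -> lmodType S,
    (forall k, finitely_generated (G k)) /\ lmod_iso (C i) (dsum G).
  have [Ccg Cproj] := CP i; have [h hE] := real_surj real (CGProj Ccg Cproj).
  have [u [uP hu]] := generated_series (xgen h).
  exists (fun k => M (u k)); split.
    by move=> k; case: (uP k) => [->|[l ->]]; [apply: fg0|apply: xfg].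
  by apply: lmod_iso_trans (lmod_iso_sym hE) _; rewrite hu; apply: real_sum.
pose G i := sval (cid (GP i)).
exists (I * nat)%type, (fun q => G q.1 q.2); split.
  by move=> [i k]; rewrite /G; case: cid => ? [].
apply: lmod_iso_trans PC _; apply: lmod_iso_trans (dsum_sigma G).
by apply: dsum_iso => i; rewrite /G; case: cid => ? [].
Qed.

(** The whole module [R] is a finite sum of generators, so that one generator
    is finitely generated and its countable multiple is that of [R], of which
    every class is a summand. *)
Lemma one_generator_fg (x : 'I_2 -> H) : generated_by2 x -> ~ pdfg R ->
  exists i j, [/\ i <> j, fg (x i), ~ fg (x j) &
    exists b, aadd (x j) b = amul Aleph0 (x i)].
Proof.
move=> xgen npdfg.
have Rcg : countably_generated (S^o : lmodType S).
  exists (fun=> 1 : S^o) => s; exists [:: (s, 0%N)].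
  by rewrite big_seq1; apply/esym/mulr1.
have [r rE] := real_surj real (CGProj Rcg (@free1_projective S)).
have rfg : fg r by apply: fg_iso (lmod_iso_sym rE) (free1_fg S).
have [u [uP ru]] := generated_series (xgen r).
have [m mE] := compact_series_cut (fg_compact rfg) ru.
have [n0 [n1 nE]] := finite_combination m uP; rewrite -{}mE in nE.
have fg0_of : (0 < n0)%N -> fg (x ord0).
  move=> n0_gt0; move: rfg; rewrite nE -(prednK n0_gt0) amulS -aaddA.
  exact: fg_summand.
have fg1_of : (0 < n1)%N -> fg (x ord_max).
  move=> n1_gt0; move: rfg; rewrite nE -(prednK n1_gt0) amulS aaddC -aaddA.
  exact: fg_summand.
have absorbed n i j : r = amul (Fin n) (x i) ->
    exists b, aadd (x j) b = amul Aleph0 (x i).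
  move=> rn; have [b bE] := complement_in_free (x j) rE.
  exists (aadd b (amul Aleph0 (x i))).
  by rewrite aaddA bE rn aaddC amul_aleph0_absorb.
have [f0|nf0] := pselect (fg (x ord0));
  have [f1|nf1] := pselect (fg (x ord_max)).
- case: npdfg; apply: fg_generators_pdfg xgen _ => i.
  case: (eqVneq i ord0) => [->//|i0].
  by have -> : i = ord_max by apply/val_inj; case: i i0 => -[|[|]].
- exists ord0, ord_max; split=> //; apply: (absorbed n0).
  by case: n1 {nE} fg1_of (nE) => [|n1] => [_ ->|/(_ isT)//];
    rewrite amul0 aaddx0.
- exists ord_max, ord0; split=> //; apply: (absorbed n1).
  by case: n0 {nE} fg0_of (nE) => [|n0] => [_ ->|/(_ isT)//];
    rewrite amul0 aadd0x.
(* If neither is finitely generated, no generator occurs in [r]. *)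
case: n0 n1 fg0_of fg1_of nE => [|n0] [|n1] fg0_of fg1_of nE;
  try by [case: nf0; apply: fg0_of|case: nf1; apply: fg1_of].
case: nf0; have [b bE] := complement_in_free (x ord0) rE.
have r0 : r = azero by rewrite nE !amul0 aaddx0.
have <- : azero = x ord0; last exact: fg0.
by symmetry; apply: (@aadd_eq0 _ _ b); rewrite bE r0; apply: asum0.
Qed.

End Realization.

(** * A generator that absorbs the other one *)

Section AbsorbingGenerator.
Local Open Scope A0.
Variables (H : aleph0_monoid) (x y : H).
Hypothesis absorb : Aleph0 * x + y = Aleph0 * x.

Lemma absorb_amul n : Aleph0 * x + n * y = Aleph0 * x.
Proof.
case: n => [n|].
  by elim: n => [|n IHn]; rewrite ?amul0 ?aaddx0 // amulS aaddA absorb.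
transitivity (Aleph0 * (Aleph0 * x + y)); last by rewrite absorb amul_aleph0K.
by rewrite amul_aleph0D amul_aleph0K.
Qed.

(** The two sequences [x, x, ...] and [y, x, x, ...] have the same sum, and
    the first step of a braiding between them makes [y] a summand of a finite
    multiple of [x]. *)
Lemma absorb_not_braiding s : in_add s x -> in_add s y -> ~ in_add x y ->
  ~ braiding_element s.
Proof.
move=> sx sy nxy braid; apply: nxy.
pose ys k := if k is 0%N then y else x.
have ysP i : in_add s (ys i) by case: i.
have sumE : asum (fun=> x) = asum ys.
  by rewrite [RHS]asum_recl -[LHS]absorb aaddC.
have [m [n [u [v [[m0 _ _] [[_ _ v0] [y0 /(_ 0%N)[x0 _]]]]]]]] :=
  (braid (fun=> x) ys (fun=> sx) ysP).1 sumE.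
rewrite v0 /fsum asum_recl /= in y0.
set w := asum _ in y0.
apply: (@in_add_intro _ _ _ (w + v 1%N) ((m 1%N).+1 - (m 0%N).+1).+1).
by rewrite aaddA [X in X + _]y0 -aaddA -x0 amulS.
Qed.

Hypothesis xcompact : compact x.

Lemma in_add_absorber : in_add y x <-> Aleph0 * y = Aleph0 * x.
Proof.
split=> [[z [n [_ xz]]]|yx]; last first.
  by apply: (compact_in_add xcompact (b := Aleph0 * x) (n := Aleph0));
     rewrite yx -amul_aleph0S.
have yE : Aleph0 * y = Aleph0 * x + Aleph0 * z.
  rewrite -[LHS](amul_aleph0_absorb n) -xz amul_aleph0D aaddA.
  by rewrite [X in X + _]aaddC absorb_amul.
by rewrite -(absorb_amul Aleph0) [in RHS]yE aaddA amul_aleph0_idem.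
Qed.

Lemma absorb_forms (k l : ecard) n : compact (Fin n * x) ->
  Fin n * x + k * y = Aleph0 * x + l * y -> in_add y x.
Proof.
(* Both sides equal [Aleph0 * x]; cancelling the compact [Fin n * x] leaves
   a tail of [Aleph0 * x] inside [k * y]. *)
rewrite absorb_amul => nxc /nxc[i [c [_ ykE]]].
apply: (compact_in_add xcompact (b := c + Aleph0 * x) (n := k)).
rewrite ykE asum_drop -[asum _]/(Aleph0 * x) aaddA [x + c]aaddC.
by rewrite -aaddA -amul_aleph0S.
Qed.

End AbsorbingGenerator.

(** * The two generators of a non-PDFG realization *)

Theorem proposition3p3 (H : aleph0_monoid) (x : 'I_2 -> H) (R : pzRingType)
  (Hgen : generated_by2 x) (Hncyc : ~ cyclic H)
  (Hpdfg : ~ pdfg R) (Hreal : aleph0_isomorphic H (V_aleph0 R)) :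
  exists i j : 'I_2, i <> j /\
    ~ in_add (x i) (x j) /\
    (Aleph0 * x i + x j = Aleph0 * x i)%A0 /\
    ~ braiding_element (x ord0 + x ord_max)%A0 /\
    (in_add (x j) (x i) <-> (Aleph0 * x j = Aleph0 * x i)%A0) /\
    (~ in_add (x j) (x i) ->
     forall (y : H) (a b a' b' : ecard),
       is_form (x i) (x j) a b y -> is_form (x i) (x j) a' b' y ->
       (ecard_finite a /\ ecard_finite a') \/
       (~ ecard_finite a /\ ~ ecard_finite a')).
Proof.
have [M real] := realization_exists Hreal.
have [i [j [ij fgi nfgj [b bE]]]] := one_generator_fg real Hgen Hpdfg.
have absorb := swindle bE.
have nadd : ~ in_add (x i) (x j) by move=> /(fg_in_add real fgi).
have in_sum l : in_add (x ord0 + x ord_max)%A0 (x l).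
  case: (eqVneq l ord0) => [->|l0].
    by apply: (@in_add_intro _ _ _ (x ord_max) 1); rewrite amul1.
  have -> : l = ord_max by apply/val_inj; case: l l0 => -[|[|]].
  by apply: (@in_add_intro _ _ _ (x ord0) 1); rewrite amul1 aaddC.
exists i, j; split=> //; split=> //; split=> //; split.
  exact: absorb_not_braiding absorb _ (in_sum i) (in_sum j) nadd.
split; first exact: in_add_absorber absorb (fg_compact real fgi).
have mixed n k l : ~ in_add (x j) (x i) ->
    (Fin n * x i + k * x j)%A0 <> (Aleph0 * x i + l * x j)%A0.
  move=> nij E; apply: nij.
  have := absorb_forms absorb (fg_compact real fgi) _ E; apply.
  exact/(fg_compact real)/fg_amul.
move=> nij y [n|] k [n'|] l -> E; [left|case: (mixed _ _ _ nij E)| |right].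
- by split; [exists n|exists n'].
- by case: (mixed _ _ _ nij (esym E)).
- by split=> -[].
Qed.
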